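(* Let $x\in\mathbb{R}^n$, $\varepsilon\in(0,1]$, $\lambda\in\mathbb{R}$, $E\in\mathbb{R}^n\setminus\{0\}$, $\sigma>0$, with $\sigma<2/(n-2)$ if $n\ge 3$. Consider the initial value problems, with the same initial datum $u_0$, $$\text{(S)}\quad i\varepsilon\partial_t u+\tfrac12\varepsilon^2\Delta u=(E\cdot x)\,u+\lambda|u|^{2\sigma}u,\qquad u_{|t=0}=u_0,$$ $$\text{(N)}\quad i\varepsilon\partial_t v+\tfrac12\varepsilon^2\Delta v=\lambda|v|^{2\sigma}v,\qquad v_{|t=0}=u_0.$$ (1) Let $v^\varepsilon$ solve (N). Define $u^\varepsilon$ by $$u^\varepsilon(t,x)=v^\varepsilon\Big(t,x+\frac{t^2}{2}E\Big)\,e^{-i\left(tE\cdot x+\frac{t^3}{6}|E|^2\right)/\varepsilon}.$$ Then $u^\varepsilon$ solves (S). (2) Conversely, if $u^\varepsilon$ solves (S), then $v^\varepsilon$, defined by $$v^\varepsilon(t,x)=u^\varepsilon\Big(t,x-\frac{t^2}{2}E\Big)\,e^{i\left(tE\cdot x-\frac{t^3}{3}|E|^2\right)/\varepsilon},$$ solves (N). (3) In particular, if the solution to (N) is unique, then so is the solution to (S), which is given by the formula in (1).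
   Context: The statement is a formal one: no function space for the datum $u_0$ or for the solutions, and no time interval, is specified. Here $u,v$ are complex-valued functions of $(t,x)$, $\Delta$ is the Laplacian in $x\in\mathbb{R}^n$, and $E\cdot x$ is the Euclidean inner product. *)

(* Defs.v *)
From HB Require Import structures.
From mathcomp Require Import all_boot all_order all_algebra.
From mathcomp Require Import all_classical all_reals all_analysis.
From mathcomp Require Import complex.

Set Implicit Arguments.
Unset Strict Implicit.
Unset Printing Implicit Defensive.

Import Order.TTheory GRing.Theory Num.Theory.
Import numFieldNormedType.Exports.

Local Open Scope ring_scope.
Local Open Scope classical_set_scope.
Local Open Scope complex_scope.

(* R^n is 'rV[R]_n; its library norm is the sup norm, so the Euclidean inner
   product is written out. *)
Definition dot (R : realType) (n : nat) (a b : 'rV[R]_n) : R :=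
  \sum_(i < n) a 0 i * b 0 i.

Section Derivatives.
Variables (R : realType) (n : nat).

Definition dt (f : R -> 'rV[R]_n -> R) (t : R) (x : 'rV[R]_n) : R :=
  'D_1 (f ^~ x) t.

Definition dx (i : 'I_n) (f : R -> 'rV[R]_n -> R) (t : R) (x : 'rV[R]_n) : R :=
  'D_(delta_mx 0 i) (f t) x.

Definition lap (f : R -> 'rV[R]_n -> R) (t : R) (x : 'rV[R]_n) : R :=
  \sum_(i < n) dx i (dx i f) t x.

Definition cont_on (I : set R) (f : R -> 'rV[R]_n -> R) : Prop :=
  {within I `*` [set: 'rV[R]_n], continuous (fun p => f p.1 p.2)}.

(* Class C^{1,2} on I * R^n, for I open: once continuously differentiable in t
   and twice in x, all derivatives being jointly continuous in (t, x). *)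
Definition C12_on (I : set R) (f : R -> 'rV[R]_n -> R) : Prop :=
  [/\ cont_on I f,
      (forall t x, I t -> derivable (f ^~ x) t 1) /\ cont_on I (dt f),
      forall i : 'I_n,
        (forall t x, I t -> derivable (f t) x (delta_mx 0 i)) /\
        cont_on I (dx i f)
    & forall i j : 'I_n,
        (forall t x, I t -> derivable (dx i f t) x (delta_mx 0 j)) /\
        cont_on I (dx j (dx i f))].

(* R[i] carries no normed module structure over R in the library, hence calculus
   on complex-valued functions goes through real and imaginary parts. *)
Definition re (u : R -> 'rV[R]_n -> R[i]) t x : R := complex.Re (u t x).
Definition im (u : R -> 'rV[R]_n -> R[i]) t x : R := complex.Im (u t x).

Definition ccont_on (I : set R) (u : R -> 'rV[R]_n -> R[i]) : Prop :=
  cont_on I (re u) /\ cont_on I (im u).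

Definition cC12_on (I : set R) (u : R -> 'rV[R]_n -> R[i]) : Prop :=
  C12_on I (re u) /\ C12_on I (im u).

Definition cdt (u : R -> 'rV[R]_n -> R[i]) t x : R[i] :=
  dt (re u) t x +i* dt (im u) t x.

Definition clap (u : R -> 'rV[R]_n -> R[i]) t x : R[i] :=
  lap (re u) t x +i* lap (im u) t x.

End Derivatives.

Definition expi (R : realType) (a : R) : R[i] := cos a +i* sin a.

(* Classical solution, on the time interval I, of
     i eps d_t u + eps^2/2 Lap u = V u + lam |u|^(2 sigma) u,  u(0) = u0:
   continuous on I * R^n, of class C^{1,2} and satisfying the equation in the
   interior of I.  For I = [0, T[ this is the usual forward problem; for I open
   the continuity condition is implied by the regularity. *)
Definition nls_solution (R : realType) (n : nat) (eps lam sigma : R)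
    (V : 'rV[R]_n -> R) (I : set R) (u0 : 'rV[R]_n -> R[i])
    (u : R -> 'rV[R]_n -> R[i]) : Prop :=
  [/\ ccont_on I u,
      cC12_on I° u,
      forall t x, I° t ->
        'i%C * eps%:C * cdt u t x + (2^-1 * eps ^+ 2)%:C * clap u t x =
        (V x)%:C * u t x
          + (lam * (ComplexField.Normc.normc (u t x) `^ (2 * sigma)))%:C * u t x
    & forall x, u 0 x = u0 x].

Definition solves_S (R : realType) (n : nat) (eps lam sigma : R)
    (E : 'rV[R]_n) (I : set R) (u0 : 'rV[R]_n -> R[i]) :
    set (R -> 'rV[R]_n -> R[i]) :=
  nls_solution eps lam sigma (dot E) I u0.

Definition solves_N (R : realType) (n : nat) (eps lam sigma : R)
    (I : set R) (u0 : 'rV[R]_n -> R[i]) : set (R -> 'rV[R]_n -> R[i]) :=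
  nls_solution eps lam sigma (fun=> 0) I u0.

Definition to_stark (R : realType) (n : nat) (eps : R) (E : 'rV[R]_n)
    (v : R -> 'rV[R]_n -> R[i]) (t : R) (x : 'rV[R]_n) : R[i] :=
  v t (x + (t ^+ 2 / 2) *: E)
    * expi (- ((t * dot E x + t ^+ 3 / 6 * dot E E) / eps)).

Definition from_stark (R : realType) (n : nat) (eps : R) (E : 'rV[R]_n)
    (u : R -> 'rV[R]_n -> R[i]) (t : R) (x : 'rV[R]_n) : R[i] :=
  u t (x - (t ^+ 2 / 2) *: E)
    * expi ((t * dot E x - t ^+ 3 / 3 * dot E E) / eps).

(* The functions are total in t; only their values for t in I matter. *)
Definition eq_on (R : realType) (n : nat) (I : set R)
    (u w : R -> 'rV[R]_n -> R[i]) : Prop :=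
  forall t x, I t -> u t x = w t x.

Definition at_most_one (R : realType) (n : nat) (I : set R)
    (A : set (R -> 'rV[R]_n -> R[i])) : Prop :=
  forall u w, A u -> A w -> eq_on I u w.

Definition is_unique (R : realType) (n : nat) (I : set R)
    (A : set (R -> 'rV[R]_n -> R[i])) (u : R -> 'rV[R]_n -> R[i]) : Prop :=
  A u /\ forall w, A w -> eq_on I w u.

(* Main.v *)
(* Both formulas are instances of one change of unknown,
     w(t, x) = u(t, x + a(t) E) exp(i theta),
     theta = - (a'(t) / eps) E.x + b(t).
   Since grad theta = - (a' / eps) E, the cross term of the Laplacian cancels
   the transport term a' E.grad u coming from the time derivative, while a''
   creates the potential a'' E.x; b absorbs what depends on t only, and |u| is
   unchanged.  The choices a = t^2/2 and a = - t^2/2 give the two parts of the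
   theorem, and the two maps are inverse to each other, which transfers
   uniqueness.
   The time derivative of u(t, x + a(t) E) needs a chain rule for a function all
   of whose partial derivatives are jointly continuous: the curve is followed
   one variable at a time, with the mean value theorem at each step. *)
Require Import Defs.
From HB Require Import structures.
From mathcomp Require Import all_boot all_order all_algebra.
From mathcomp Require Import all_classical all_reals all_analysis.
From mathcomp Require Import complex.
From mathcomp Require Import ring lra.

Set Implicit Arguments.
Unset Strict Implicit.
Unset Printing Implicit Defensive.

Import Order.TTheory GRing.Theory Num.Theory.
Import numFieldNormedType.Exports.

Local Open Scope ring_scope.
Local Open Scope classical_set_scope.
Local Open Scope complex_scope.

(** * Derivatives along curves, and the chain rule from partial derivatives *)

Lemma is_derive_cvgP (R : realType) (V W : normedModType R) (f : V -> W)
    (x v : V) (d : W) :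
  is_derive x v f d <->
  h^-1 *: (f (h *: v + x) - f x) @[h --> 0^'] --> d.
Proof.
split=> [[+ <-]|fd]; first exact.
by apply: DeriveDef; [apply/cvg_ex; exists d | exact: cvg_lim fd].
Qed.

(** [F] is merely continuous at t, so the product rule does not apply; but [r h - r t] vanishes at
    t, and the difference quotient is exactly [F] times that of [r]. *)
Lemma is_derive_vanishing_mul (R : realType) (F r : R -> R) (t dr : R) :
  {for t, continuous F} -> is_derive t 1 r dr ->
  is_derive t 1 (fun h => F h * (r h - r t)) (F t * dr).
Proof.
move=> Fc /is_derive_cvgP rd; apply/is_derive_cvgP.
rewrite [X in X @ _ --> _](_ : _ = fun h =>
  F (h *: 1 + t) * (h^-1 *: (r (h *: 1 + t) - r t))); last first.
  by apply/funext => h; rewrite subrr mulr0 subr0 /GRing.scale /= mulrCA.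
apply: cvgM => //; apply: cvg_within_filter.
apply: cvg_comp; last exact: Fc.
have {2}-> : t = 0 *: 1 + t by rewrite scale0r add0r.
apply: cvgD; last exact: cvg_cst.
by apply: cvgZ; [exact: cvg_id | exact: cvg_cst].
Qed.

(** [q] is the slope of [g^~ z] between [r0] and r, completed by [dg] at r = [r0]. The mean value
    theorem turns each slope into a value of [dg] at an intermediate point, and joint continuity of
    [dg] gives the limit as r and z vary together. *)
Lemma slope_cvg (R : realType) (V : normedModType R) (g dg : R -> V -> R)
    (r0 : R) (z0 : V) :
  nbhs r0 [set r : R | forall z, is_derive r 1 (g^~ z) (dg r z)] ->
  {for (r0, z0), continuous (fun p : R * V => dg p.1 p.2)} ->
  exists q : R -> V -> R,
    [/\ (fun p : R * V => q p.1 p.2) @ (r0, z0) --> dg r0 z0, q r0 z0 = dg r0 z0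
      & forall r z, g r z - g r0 z = q r z * (r - r0)].
Proof.
move=> dgg dgc.
exists (fun r z => if r == r0 then dg r0 z else (g r z - g r0 z) / (r - r0)).
split=> [||r z]; [|by rewrite eqxx|]; last first.
  have [->|rr0] := eqVneq r r0; first by rewrite !subrr mulr0.
  by rewrite divfK// subr_eq0.
apply/cvgrPdist_lt => e e0.
have [[A B] /= [A0 B0] AB] : nbhs (r0, z0) [set p : R * V |
    is_derive p.1 1 (g^~ p.2) (dg p.1 p.2) /\ `|dg r0 z0 - dg p.1 p.2| < e].
  apply: filterI.
    exists ([set r : R | forall z, is_derive r 1 (g^~ z) (dg r z)], setT).
      by split => //; exact: filterT.
    by move=> [r z] [/= + _]; apply.
  by have /cvgrPdist_lt := dgc; apply.
have /nbhs_ballP[d /= d0 dA] := A0.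
exists (ball r0 d, B) => [|[r z] [/= rd Bz] /=].
  by split => //=; exact: nbhsx_ballx.
(* Any s no farther from [r0] than r stays in the ball, so both properties hold at (s, z). *)
have mv s : `|s - r0| <= `|r - r0| -> is_derive s 1 (g^~ z) (dg s z) /\
    `|dg r0 z0 - dg s z| < e.
  move=> sr; apply: (AB (s, z)); split => //=; apply: dA.
  by rewrite /ball /= distrC (le_lt_trans sr)// distrC.
have [_|rr0] := eqVneq r r0; first by apply: (mv r0 _).2; rewrite subrr normr0.
suff [s sr ->] : exists2 s, `|s - r0| <= `|r - r0| &
    (g r z - g r0 z) / (r - r0) = dg s z by exact: (mv s sr).2.
have cont a b : (forall s, s \in `[a, b]%R -> `|s - r0| <= `|r - r0|) ->
    {within `[a, b], continuous (g^~ z)}.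
  move=> ab; apply: derivable_within_continuous => s sab.
  by have [[]] := mv s (ab s sab).
(* The endpoints will be r and [r0], in whichever order is increasing. *)
have MV a b : a < b -> (forall s, s \in `[a, b]%R -> `|s - r0| <= `|r - r0|) ->
    exists2 s, `|s - r0| <= `|r - r0| & g b z - g a z = dg s z * (b - a).
  move=> altb ab.
  have oo s (sab : s \in `]a, b[%R) := ab s (subset_itv_oo_cc sab).
  have [s /oo sr sE] :=
    MVT altb (fun s sab => (mv s (oo s sab)).1) (cont a b ab).
  by exists s.
have := rr0; rewrite neq_lt => /orP[lt|lt].
  have [s|s sr sE] := MV _ _ lt.
    rewrite in_itv /= => /andP[rs sr0].
    by rewrite !ler0_norm ?subr_le0 ?(le_trans rs)// lerN2 lerB.
  by exists s => //; rewrite -opprB sE -mulrN opprB mulfK// subr_eq0.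
have [s|s sr sE] := MV _ _ lt.
  rewrite in_itv /= => /andP[rs sr0].
  by rewrite !ger0_norm ?subr_ge0 ?(le_trans rs)// lerB.
by exists s => //; rewrite sE mulfK// subr_eq0.
Qed.

Lemma is_derive_curve2 (R : realType) (V : normedModType R)
    (g dg : R -> V -> R) (r : R -> R) (c : R -> V) (t dr d : R) :
  nbhs (r t) [set s : R | forall z, is_derive s 1 (g^~ z) (dg s z)] ->
  {for (r t, c t), continuous (fun p : R * V => dg p.1 p.2)} ->
  is_derive t 1 r dr -> {for t, continuous c} ->
  is_derive t 1 (fun h => g (r t) (c h)) d ->
  is_derive t 1 (fun h => g (r h) (c h)) (dg (r t) (c t) * dr + d).
Proof.
move=> dgg dgc rd cc gd.
have [q [qc q0 qE]] := slope_cvg dgg dgc.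
have -> : (fun h => g (r h) (c h)) =
    (fun h => q (r h) (c h) * (r h - r t)) + (fun h => g (r t) (c h)).
  by apply/funext => h; rewrite fctE -qE subrK.
rewrite -q0; apply: is_deriveD; apply: is_derive_vanishing_mul.
have rc : {for t, continuous r}.
  by apply/differentiable_continuous/derivable1_diffP; case: rd.
rewrite /prop_for /continuous_at q0.
exact: (@cvg_comp _ _ _ (fun h => (r h, c h)) (fun p : R * V => q p.1 p.2) _ _ _
  (cvg_pair rc cc) qc).
Qed.

(** The two difference quotients coincide. This brings directional derivatives within reach of
    one-variable results. *)
Lemma is_derive_line (R : realType) (V W : normedModType R) (f : V -> W)
    (x v : V) (r : R) (d : W) :
  is_derive (x + r *: v) v f d <-> is_derive r 1 (fun s => f (x + s *: v)) d.
Proof.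
rewrite !is_derive_cvgP; set q := (X in X @ _ --> _ <-> _).
rewrite (_ : (fun h : R => _ *: (f (x + _ *: v) - _)) = q) //.
apply/funext => h; rewrite /q; congr (_ *: (f _ - _)).
by rewrite [h *: 1]mulr1 scalerDl addrCA.
Qed.

Lemma is_derive_continuous (R : realType) (W : normedModType R) (f : R -> W)
    (t : R) (d : W) :
  is_derive t 1 f d -> {for t, continuous f}.
Proof. by case=> fd _; apply/differentiable_continuous/derivable1_diffP. Qed.

(** Induction on the list of coordinates allowed to move, with one use of [is_derive_curve2] per
    coordinate; the list of all coordinates gives the curve of the statement. *)
Lemma is_derive_partials (R : realType) (n : nat) (G : 'rV[R]_n -> R)
    (dG : 'I_n -> 'rV[R]_n -> R) (y E : 'rV[R]_n) (a : R -> R) (t da : R) :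
  (forall i z, is_derive z (delta_mx 0 i) G (dG i z)) ->
  (forall i, {for y, continuous (dG i)}) ->
  is_derive t 1 a da ->
  is_derive t 1 (fun h => G (y + (a h - a t) *: E))
    (da * \sum_(i < n) E 0 i * dG i y).
Proof.
move=> GdG dGc ad.
have rd i : is_derive t 1 (fun h => (a h - a t) * E 0 i) (da * E 0 i).
  have -> : (fun h => (a h - a t) * E 0 i) = E 0 i \*: (a - cst (a t)).
    by apply/funext => h; rewrite mulrC.
  by apply: is_derive_eq; rewrite subr0 mulrC.
(* Only the coordinates listed in [s] move along this curve, which is at [y] when h = t. *)
pose c s h :=
  y + \sum_(i <- s) ((a h - a t) * E 0 i) *: (delta_mx 0 i : 'rV[R]_n).
have ct s : c s t = y.
  by rewrite /c big1 ?addr0// => i _; rewrite subrr mul0r scale0r.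
have cc s : {for t, continuous (c s)}.
  apply: cvgD; first exact: cvg_cst.
  apply: cvg_big => [|i _]; first exact: add_continuous.
  apply: cvgZ; last exact: cvg_cst.
  exact: is_derive_continuous (rd i).
suff H s : is_derive t 1 (fun h => G (c s h))
    (da * \sum_(i <- s) E 0 i * dG i y).
  have -> : (fun h => G (y + (a h - a t) *: E)) =
      (fun h => G (c (enum 'I_n) h)).
    apply/funext => h; congr (G (y + _)).
    rewrite {1}(row_sum_delta E) scaler_sumr big_enum.
    by apply: eq_bigr => i _; rewrite scalerA.
  by have := H (enum 'I_n); rewrite big_enum.
elim: s => [|i s IHs].
  rewrite big_nil mulr0 (_ : (fun h => _) = cst (G y)).
    exact: is_derive_cst.
  by apply/funext => h; rewrite /c big_nil addr0.
(* Coordinate [i] becomes the scalar variable; [z] will follow the curve of the remaining list. *)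
pose g (r : R) (z : 'rV[R]_n) := G (z + r *: (delta_mx 0 i : 'rV[R]_n)).
pose dg (r : R) (z : 'rV[R]_n) := dG i (z + r *: (delta_mx 0 i : 'rV[R]_n)).
have -> : (fun h => G (c (i :: s) h)) =
    (fun h => g ((a h - a t) * E 0 i) (c s h)).
  by apply/funext => h; rewrite /g /c big_cons addrCA addrC.
have r0 : (a t - a t) * E 0 i = 0 by rewrite subrr mul0r.
have gd : is_derive t 1 (fun h => g ((a t - a t) * E 0 i) (c s h))
    (da * \sum_(i <- s) E 0 i * dG i y).
  rewrite r0 (_ : (fun h => _) = (fun h => G (c s h)))//.
  by apply/funext => h; rewrite /g scale0r addr0.
have dg0 : dg 0 y = dG i y by rewrite /dg scale0r addr0.
have gdg : nbhs ((a t - a t) * E 0 i)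
    [set r : R | forall z, is_derive r 1 (g^~ z) (dg r z)].
  by apply: filterE => r z; exact: (iffLR (is_derive_line G z _ r _) (GdG i _)).
have dgc : {for ((a t - a t) * E 0 i, c s t),
    continuous (fun p : R * 'rV[R]_n => dg p.1 p.2)}.
  rewrite r0 ct.
  have sc : (fun p : R * 'rV[R]_n => p.2 + p.1 *: (delta_mx 0 i : 'rV[R]_n))
      @ nbhs (0 : R, y) --> y.
    rewrite -[X in _ --> X]addr0 -(scale0r (delta_mx 0 i)).
    apply: cvgD; first exact: cvg_snd.
    by apply: cvgZ; [exact: cvg_fst|exact: cvg_cst].
  have := cvg_comp _ _ sc (dGc i).
  by rewrite /prop_for /continuous_at /dg scale0r addr0.
have gcd := is_derive_curve2 (r := fun h => (a h - a t) * E 0 i) (c := c s)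
  gdg dgc (rd i) (@cc s) gd.
apply: (is_derive_eq gcd).
by rewrite r0 ct dg0 big_cons mulrDr mulrC mulrA.
Qed.

(** Restricting to the line through x along v reduces this to the chain rule for real functions. *)
Lemma is_derive_scalar_comp (R : realType) (V : normedModType R) (h : R -> R)
    (f : V -> R) (x v : V) (dh df : R) :
  is_derive (f x) 1 h dh -> is_derive x v f df ->
  is_derive x v (h \o f) (dh * df).
Proof.
have x0 : x = x + (0 : R) *: v by rewrite scale0r addr0.
rewrite {1 2 3}x0 => hd /is_derive_line fd; apply/is_derive_line.
exact: (is_derive1_comp (g := fun s => f (x + s *: v)) hd fd).
Qed.

(** * Joint continuity in time and space *)

Section Continuity.
Variables (R : realType) (n : nat) (I : set R).
Implicit Types (f g : R -> 'rV[R]_n -> R) (a : R -> R).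

Let slab := I `*` [set: 'rV[R]_n].

Lemma cont_onP f : cont_on I f <->
  forall t x, I t ->
    (fun p : R * 'rV[R]_n => f p.1 p.2) @ within slab (nbhs (t, x)) --> f t x.
Proof.
rewrite /cont_on subspace_continuousP; split=> [fc t x It|fc [t x] [/= It _]].
  by apply: (fc (t, x)).
exact: fc.
Qed.

Lemma cont_on_continuous f t x : open I -> I t -> cont_on I f ->
  {for (t, x), continuous (fun p : R * 'rV[R]_n => f p.1 p.2)}.
Proof.
move=> Io It fc.
have slabo : open slab.
  rewrite openE => -[s y] [/= Is _]; exists (I, setT) => //=.
  by split; [rewrite openE in Io; exact: Io|exact: filterT].
have := fc; rewrite /cont_on continuous_open_subspace//; apply.
by rewrite inE.
Qed.

(** Serves to transfer continuity to [dt] and [dx] of a function, whose values are known only at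
    times in [I]. *)
Lemma eq_cont_on f g : (forall t x, I t -> f t x = g t x) ->
  cont_on I f -> cont_on I g.
Proof.
move=> fg; rewrite !cont_onP => fc t x It; rewrite -fg//.
apply: cvg_trans (fc t x It); apply: fmap_within_eq => -[s y].
by rewrite inE => -[/fg].
Qed.

Lemma cont_onD f g : cont_on I f -> cont_on I g ->
  cont_on I (fun t x => f t x + g t x).
Proof.
by rewrite !cont_onP => fc gc t x It; apply: cvgD; [exact: fc|exact: gc].
Qed.

Lemma cont_onM f g : cont_on I f -> cont_on I g ->
  cont_on I (fun t x => f t x * g t x).
Proof.
by rewrite !cont_onP => fc gc t x It; apply: cvgM; [exact: fc|exact: gc].
Qed.

Lemma cont_on_comp (h : R -> R) f : continuous h -> cont_on I f ->
  cont_on I (fun t x => h (f t x)).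
Proof.
rewrite !cont_onP => hc fc t x It.
by apply: cvg_comp (fc t x It) _; exact: hc.
Qed.

Lemma cont_on_time a : continuous a -> cont_on I (fun t (_ : 'rV[R]_n) => a t).
Proof.
move=> ac; apply/cont_onP => t x It; apply: cvg_within_filter.
by apply: cvg_comp; [exact: cvg_fst|exact: ac].
Qed.

Lemma cont_on_cst (k : R) : cont_on I (fun _ (_ : 'rV[R]_n) => k).
Proof. by apply: (@cont_on_time (cst k)); exact: cst_continuous. Qed.

Lemma cont_on_sum (f : 'I_n -> R -> 'rV[R]_n -> R) :
  (forall i, cont_on I (f i)) -> cont_on I (fun t x => \sum_(i < n) f i t x).
Proof.
move=> fc; apply/cont_onP => t x It; apply: cvg_big => [|i _].
  exact: add_continuous.
by have /cont_onP := fc i; apply.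
Qed.

Lemma cont_on_dot (E : 'rV[R]_n) : cont_on I (fun=> dot E).
Proof.
apply: cont_on_sum => i; apply: cont_onM; first exact: cont_on_cst.
apply/cont_onP => t x It; apply: cvg_within_filter.
apply: (@cvg_comp _ _ _ snd (fun z : 'rV[R]_n => z 0 i) _ (nbhs x)).
  exact: cvg_snd.
exact: coord_continuous.
Qed.

(** The shear [sh] does not change the time, so it maps the slab into itself and relative limits are
    preserved, even if [I] is not open. *)
Lemma cont_on_shift f a (E : 'rV[R]_n) : continuous a -> cont_on I f ->
  cont_on I (fun t x => f t (x + a t *: E)).
Proof.
rewrite !cont_onP => ac fc t x It.
pose sh (p : R * 'rV[R]_n) := (p.1, p.2 + a p.1 *: E).
apply: (@cvg_comp _ _ _ sh (fun p : R * _ => f p.1 p.2) _ _ _ _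
  (fc t (x + a t *: E) It)).
have sh2 : (sh p).2 @[p --> nbhs (t, x)] --> x + a t *: E.
  apply: cvgD; first exact: cvg_snd.
  apply: cvgZ; last exact: cvg_cst.
  by apply: (@cvg_comp _ _ _ fst a _ (nbhs t)); [exact: cvg_fst|exact: ac].
have shc : sh @ nbhs (t, x) --> nbhs (t, x + a t *: E).
  exact: (cvg_pair cvg_fst sh2).
move=> A /shc; rewrite /= !nbhs_simpl /within /=.
by apply: filterS => -[s y] /= Ash [Is _]; apply: Ash.
Qed.

End Continuity.

(** * Calculus of class C^{1,2} with explicit derivatives *)

Lemma is_derive_mul (R : realType) (V : normedModType R) (f g : V -> R)
    (x v : V) (df dg : R) :
  is_derive x v f df -> is_derive x v g dg ->
  is_derive x v (fun z => f z * g z) (f x * dg + g x * df).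
Proof. by move=> fd gd; exact: (is_deriveM fd gd). Qed.

(* The derivatives are carried as functions, because the total operators dt and
   dx commute with sums and products only on J. *)
Record jet (R : realType) (n : nat) (J : set R) (f ft : R -> 'rV[R]_n -> R)
    (fx : 'I_n -> R -> 'rV[R]_n -> R)
    (fxx : 'I_n -> 'I_n -> R -> 'rV[R]_n -> R) : Prop := Jet {
  jet_cont : cont_on J f;
  jet_cont_t : cont_on J ft;
  jet_cont_x : forall i, cont_on J (fx i);
  jet_cont_xx : forall i j, cont_on J (fxx i j);
  jet_t : forall t x, J t -> is_derive t 1 (f^~ x) (ft t x);
  jet_x : forall i t x, J t -> is_derive x (delta_mx 0 i) (f t) (fx i t x);
  jet_xx : forall i j t x, J t ->
    is_derive x (delta_mx 0 j) (fx i t) (fxx i j t x) }.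

Section Jets.
Variables (R : realType) (n : nat) (J : set R).
Implicit Types (f g ft gt : R -> 'rV[R]_n -> R).
Implicit Types (fx gx : 'I_n -> R -> 'rV[R]_n -> R).
Implicit Types (fxx gxx : 'I_n -> 'I_n -> R -> 'rV[R]_n -> R).

Lemma C12_on_jet f : C12_on J f ->
  jet J f (dt f) (fun i => dx i f) (fun i j => dx j (dx i f)).
Proof.
case=> fc [fdt fct] fx fxx; split=> //.
- by move=> i; case: (fx i).
- by move=> i j; case: (fxx i j).
- by move=> t x Jt; apply: DeriveDef => //; exact: fdt.
- by move=> i t x Jt; apply: DeriveDef => //; exact: (fx i).1.
- by move=> i j t x Jt; apply: DeriveDef => //; exact: (fxx i j).1.
Qed.

Section JetDerivatives.
Context f ft fx fxx (jf : jet J f ft fx fxx).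

Lemma jet_dt t x : J t -> dt f t x = ft t x.
Proof. by move=> Jt; case: (jet_t jf x Jt). Qed.

(** An equality of functions of x at fixed time, so that it can be rewritten under a second space
    derivative. *)
Lemma jet_dx i t : J t -> dx i f t = fx i t.
Proof.
by move=> Jt; apply/funext => x; case: (jet_x jf i x Jt).
Qed.

Lemma jet_dxx i j t x : J t -> dx j (dx i f) t x = fxx i j t x.
Proof.
move=> Jt; rewrite {1}/dx (jet_dx i Jt).
by case: (jet_xx jf i j x Jt).
Qed.

Lemma jet_lap t x : J t -> lap f t x = \sum_(i < n) fxx i i t x.
Proof. by move=> Jt; apply: eq_bigr => i _; exact: jet_dxx. Qed.

Lemma jet_C12_on : C12_on J f.
Proof.
split=> [||i|i j]; first exact: jet_cont jf.
- split=> [t x Jt|]; first by case: (jet_t jf x Jt).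
  apply: (@eq_cont_on _ _ _ ft); last exact: jet_cont_t jf.
  by move=> t x Jt; rewrite jet_dt.
- split=> [t x Jt|]; first by case: (jet_x jf i x Jt).
  apply: (@eq_cont_on _ _ _ (fx i)); last exact: jet_cont_x jf i.
  by move=> t x Jt; rewrite jet_dx.
- split=> [t x Jt|].
    by rewrite (jet_dx i Jt); case: (jet_xx jf i j x Jt).
  apply: (@eq_cont_on _ _ _ (fxx i j)); last exact: jet_cont_xx jf i j.
  by move=> t x Jt; rewrite jet_dxx.
Qed.

End JetDerivatives.

Lemma jetD f ft fx fxx g gt gx gxx : jet J f ft fx fxx -> jet J g gt gx gxx ->
  jet J (fun t x => f t x + g t x) (fun t x => ft t x + gt t x)
    (fun i t x => fx i t x + gx i t x)
    (fun i j t x => fxx i j t x + gxx i j t x).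
Proof.
case=> fc fct fcx fcxx fdt fdx fdxx [gc gct gcx gcxx gdt gdx gdxx].
split=> [||i|i j|t x Jt|i t x Jt|i j t x Jt]; try exact: cont_onD.
- exact: (is_deriveD (fdt t x Jt) (gdt t x Jt)).
- exact: (is_deriveD (fdx i t x Jt) (gdx i t x Jt)).
- exact: (is_deriveD (fdxx i j t x Jt) (gdxx i j t x Jt)).
Qed.

Lemma jetM f ft fx fxx g gt gx gxx : jet J f ft fx fxx -> jet J g gt gx gxx ->
  jet J (fun t x => f t x * g t x) (fun t x => f t x * gt t x + g t x * ft t x)
    (fun i t x => f t x * gx i t x + g t x * fx i t x)
    (fun i j t x => (f t x * gxx i j t x + gx i t x * fx j t x)
                  + (g t x * fxx i j t x + fx i t x * gx j t x)).
Proof.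
case=> fc fct fcx fcxx fdt fdx fdxx [gc gct gcx gcxx gdt gdx gdxx].
split=> [||i|i j|t x Jt|i t x Jt|i j t x Jt];
  try by repeat (apply: cont_onM || apply: cont_onD).
- exact: (is_derive_mul (fdt t x Jt) (gdt t x Jt)).
- exact: (is_derive_mul (fdx i t x Jt) (gdx i t x Jt)).
- exact: (is_deriveD (is_derive_mul (fdx j t x Jt) (gdxx i j t x Jt))
                     (is_derive_mul (gdx j t x Jt) (fdxx i j t x Jt))).
Qed.

(** Meant for [h] equal to [cos], [sin] or [- sin], composed with the phase; [h1] and [h2] are its
    first two derivatives. *)
Lemma jet_comp (h h1 h2 : R -> R) f ft fx fxx : continuous h2 ->
  (forall r : R, is_derive r 1 h (h1 r)) ->
  (forall r : R, is_derive r 1 h1 (h2 r)) ->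
  jet J f ft fx fxx ->
  jet J (fun t x => h (f t x)) (fun t x => h1 (f t x) * ft t x)
    (fun i t x => h1 (f t x) * fx i t x)
    (fun i j t x => h1 (f t x) * fxx i j t x
                  + fx i t x * (h2 (f t x) * fx j t x)).
Proof.
move=> h2c hd h1d [fc fct fcx fcxx fdt fdx fdxx].
have hc : continuous h by move=> r; exact: is_derive_continuous (hd r).
have h1c : continuous h1 by move=> r; exact: is_derive_continuous (h1d r).
split=> [||i|i j|t x Jt|i t x Jt|i j t x Jt];
  try by repeat (apply: cont_onM || apply: cont_onD || apply: cont_on_comp).
- exact: (is_derive_scalar_comp (hd _) (fdt t x Jt)).
- exact: (is_derive_scalar_comp (hd _) (fdx i t x Jt)).
- exact: (is_derive_mul (is_derive_scalar_comp (h1d _) (fdx j t x Jt))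
                        (fdxx i j t x Jt)).
Qed.

(** This is the jet of the phase: affine in x, hence with constant gradient at each time and no
    second derivatives. *)
Lemma jet_affine (m m1 b b1 : R -> R) (E : 'rV[R]_n) :
  continuous m1 -> continuous b1 ->
  (forall r : R, is_derive r 1 m (m1 r)) ->
  (forall r : R, is_derive r 1 b (b1 r)) ->
  jet J (fun t x => m t * dot E x + b t) (fun t x => m1 t * dot E x + b1 t)
    (fun i t _ => m t * E 0 i) (fun _ _ _ _ => 0).
Proof.
move=> m1c b1c md bd.
have mc : continuous m by move=> r; exact: is_derive_continuous (md r).
have bc : continuous b by move=> r; exact: is_derive_continuous (bd r).
split.
- by apply: cont_onD (cont_on_time bc); apply: cont_onM (cont_on_time mc) _;
    exact: cont_on_dot.
- by apply: cont_onD (cont_on_time b1c); apply: cont_onM (cont_on_time m1c) _;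
    exact: cont_on_dot.
- move=> i; apply: cont_on_time => t.
  by apply: cvgM; [exact: mc|exact: cvg_cst].
- by move=> i j; exact: cont_on_cst.
- move=> t x _; apply: is_deriveD.
  apply: (@is_derive_eq _ _ _ (m * cst (dot E x))).
  by rewrite scaler0 add0r mulrC.
(* The difference quotient equals [m t * E 0 i] for every nonzero h. *)
- move=> i t x _; apply: (iffRL (is_derive_cvgP _ _ _ _)).
  apply: cvg_near_cst; near=> h.
  rewrite opprD addrACA subrr addr0 -mulrBr.
  have -> : dot E (h *: delta_mx 0 i + x) - dot E x = h * E 0 i.
    rewrite /dot -sumrB (bigD1 i)//= big1 ?addr0 => [|j ji]; last first.
      by rewrite !mxE eqxx (negPf ji) mulr0 add0r subrr.
    by rewrite !mxE !eqxx /= mulr1; ring.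
  rewrite /GRing.scale /= mulrCA mulKf//.
  by near: h; exact: nbhs_dnbhs_neq.
- by move=> i j t x _; exact: is_derive_cst.
Unshelve. all: by end_near. Qed.

(** Space derivatives commute with the translation. The time derivative gains a transport term, and
    openness of [J] supplies the neighbourhood of t that [is_derive_curve2] asks for. *)
Lemma jet_shift (a a1 : R -> R) (E : 'rV[R]_n) f ft fx fxx :
  open J -> continuous a1 -> (forall r : R, is_derive r 1 a (a1 r)) ->
  jet J f ft fx fxx ->
  jet J (fun t x => f t (x + a t *: E))
    (fun t x => ft t (x + a t *: E)
              + a1 t * \sum_(i < n) E 0 i * fx i t (x + a t *: E))
    (fun i t x => fx i t (x + a t *: E))
    (fun i j t x => fxx i j t (x + a t *: E)).
Proof.
move=> oJ a1c ad [fc fct fcx fcxx fdt fdx fdxx].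
have ac : continuous a by move=> r; exact: is_derive_continuous (ad r).
have shiftD (g : 'rV[R]_n -> R) (x y v : 'rV[R]_n) d :
    is_derive (x + y) v g d -> is_derive x v (fun z => g (z + y)) d.
  rewrite -[y in x + y]addr0; rewrite !is_derive_cvgP.
  by under eq_fun do rewrite addr0 addrA.
split.
- exact: cont_on_shift.
- apply: cont_onD; first exact: cont_on_shift.
  apply: cont_onM; first exact: cont_on_time.
  apply: cont_on_sum => i.
  apply: cont_onM; [exact: cont_on_cst|exact: cont_on_shift].
- by move=> i; exact: cont_on_shift.
- by move=> i j; exact: cont_on_shift.
- move=> t x Jt; set y := x + a t *: E.
  have cs : {for t, continuous (fun s => x + a s *: E)}.
    by apply: cvgD; [exact: cvg_cst|apply: cvgZ; [exact: ac|exact: cvg_cst]].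
  have fxc i : {for y, continuous (fx i t)}.
    have tz : (t, z) @[z --> y] --> (t, y).
      apply: (@cvg_pair _ _ _ (nbhs y) (nbhs t) (nbhs y) _ _ _ (cst t) id).
        exact: cvg_cst.
      exact: cvg_id.
    exact: (cvg_comp _ _ tz (cont_on_continuous (x := y) oJ Jt (fcx i))).
  (* Recentring the curve at [y], its position at time t, puts it in the form of
     [is_derive_partials]. *)
  have fE : (fun h => f t (y + (a h - a t) *: E)) =
      (fun h => f t (x + a h *: E)).
    by apply/funext => h; rewrite /y scalerBl addrA addrAC addrK.
  have := is_derive_partials (dG := fun i => fx i t) E
    (fun i z => fdx i t z Jt) fxc (ad t).
  rewrite fE => gd.
  have nJ : nbhs t [set s : R | forall z, is_derive s 1 (f^~ z) (ft s z)].
    by rewrite openE in oJ; apply: filterS (oJ t Jt) => s Js z; exact: fdt.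
  have := is_derive_curve2 (g := f) (dg := ft) (r := id)
    (c := fun s => x + a s *: E) nJ (cont_on_continuous (x := y) oJ Jt fct)
    (is_derive_id t 1) cs gd.
  by rewrite mulr1.
- by move=> i t x Jt; apply: shiftD; exact: fdx.
- by move=> i j t x Jt; apply: shiftD; exact: fdxx.
Qed.

End Jets.

(** * The equation in an accelerated frame *)

(** The left side is the trace of second derivatives as [jetM], [jet_comp] and [jet_affine] produce
    it, for [p] times a function of the phase; [c], [c1], [c2] are the values of that function and
    its two derivatives. *)
Lemma sum_jet_laplacian (R : realType) (n : nat) (E : 'rV[R]_n)
    (p c c1 c2 m : R) (px pxx : 'I_n -> R) :
  \sum_(i < n) p * (c1 * 0 + m * E 0 i * (c2 * (m * E 0 i)))
    + \sum_(i < n) c1 * (m * E 0 i) * px i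
    + (\sum_(i < n) c * pxx i + \sum_(i < n) px i * (c1 * (m * E 0 i))) =
  p * c2 * m ^+ 2 * dot E E + 2 * c1 * m * (\sum_(i < n) E 0 i * px i)
    + c * \sum_(i < n) pxx i.
Proof.
rewrite /dot !mulr_sumr -!big_split /=; apply: eq_bigr => i _; ring.
Qed.

Lemma normc_expi (R : realType) (r : R) : ComplexField.Normc.normc (expi r) = 1.
Proof. by rewrite /= cos2Dsin2 sqrtr1. Qed.

Lemma expiD (R : realType) (r s : R) : expi (r + s) = expi r * expi s.
Proof.
by apply/eqP; rewrite eq_complex /= cosD sinD eqxx addrC eqxx.
Qed.

Lemma expi0 (R : realType) : expi (0 : R) = 1.
Proof. by rewrite /expi cos0 sin0. Qed.

(** Here [c] and [s] stand for the cosine and sine of the phase, [Gp] and [Gq] for the derivatives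
    of the two parts along E. Once the transport and cross terms cancel, the new equation is the old
    one multiplied by c + i s. *)
Lemma frame_equation (R : realType)
    (eps P Q Pt Qt Gp Gq Lp Lq c s A1 A2 B1 Ex EE v N : R) :
  let th1 := - (A2 / eps) * Ex + B1 in let m := - (A1 / eps) in
  eps != 0 ->
  'i%C * eps%:C * (Pt +i* Qt) + (2^-1 * eps ^+ 2)%:C * (Lp +i* Lq) =
    v%:C * (P +i* Q) + N%:C * (P +i* Q) ->
  'i%C * eps%:C *
    ((P * (- s * th1) + c * (Pt + A1 * Gp)
      + (Q * (- c * th1) + - s * (Qt + A1 * Gq)))
     +i* (P * (c * th1) + s * (Pt + A1 * Gp)
      + (Q * (- s * th1) + c * (Qt + A1 * Gq))))
  + (2^-1 * eps ^+ 2)%:C *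
    ((P * - c * m ^+ 2 * EE + 2 * - s * m * Gp + c * Lp
      + (Q * s * m ^+ 2 * EE + 2 * - c * m * Gq + - s * Lq))
     +i* (P * - s * m ^+ 2 * EE + 2 * c * m * Gp + s * Lp
      + (Q * - c * m ^+ 2 * EE + 2 * - s * m * Gq + c * Lq))) =
  (v + A2 * Ex - eps * B1 - A1 ^+ 2 / 2 * EE)%:C
    * ((P * c + Q * - s) +i* (P * s + Q * c))
  + N%:C * ((P * c + Q * - s) +i* (P * s + Q * c)).
Proof.
move=> th1 m eps0 /eqP; rewrite eq_complex /= => /andP[].
rewrite -subr_eq0 => /eqP eqr; rewrite -subr_eq0 => /eqP eqi.
have lin (k l x y z : R) : x = 0 -> y = 0 -> z = k * x + l * y -> z = 0.
  by move=> -> -> ->; rewrite !mulr0 addr0.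
apply/eqP; rewrite eq_complex /=; apply/andP; split; apply/eqP/subr0_eq.
  (* The real part of the product by c + i s; the next line is the imaginary part. *)
  by apply: (lin c (- s) _ _ _ eqr eqi); rewrite /th1 /m; field.
by apply: (lin s c _ _ _ eqr eqi); rewrite /th1 /m; field.
Qed.

(** The condition on [W] says that the time-dependent terms of the potential in the moving frame add
    up to a function of x alone. Vanishing of [a], [a1] and [b] at 0 makes the transform the
    identity there, which keeps the datum. *)
Lemma nls_accelerated_frame (R : realType) (n : nat) (eps lam sigma : R)
    (E : 'rV[R]_n) (a a1 a2 b b1 : R -> R) (V W : 'rV[R]_n -> R) (I : set R)
    (u0 : 'rV[R]_n -> R[i]) (u : R -> 'rV[R]_n -> R[i]) :
  eps != 0 -> continuous a2 -> continuous b1 ->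
  (forall r : R, is_derive r 1 a (a1 r)) ->
  (forall r : R, is_derive r 1 a1 (a2 r)) ->
  (forall r : R, is_derive r 1 b (b1 r)) ->
  a 0 = 0 -> a1 0 = 0 -> b 0 = 0 ->
  (forall t x, W x = V (x + a t *: E) + a2 t * dot E x - eps * b1 t
                     - a1 t ^+ 2 / 2 * dot E E) ->
  nls_solution eps lam sigma V I u0 u ->
  nls_solution eps lam sigma W I u0
    (fun t x => u t (x + a t *: E) * expi (- (a1 t / eps) * dot E x + b t)).
Proof.
move=> eps0 a2c b1c ad a1d bd a0 a10 b0 WV [[rc ic] [r12 i12] eqn ini].
have ac : continuous a by move=> r; exact: is_derive_continuous (ad r).
have a1c : continuous a1 by move=> r; exact: is_derive_continuous (a1d r).
pose m (t : R) := - (a1 t / eps); pose m1 (t : R) := - (a2 t / eps).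
have md (r : R) : is_derive r 1 m (m1 r).
  have -> : m = (- eps^-1) \*: a1 by apply/funext => s; rewrite /m -mulrN mulrC.
  by apply: is_derive_eq; rewrite /m1 -mulrN mulrC.
have m1c : continuous m1.
  by move=> r; apply: cvgN; apply: cvgM; [exact: a2c|exact: cvg_cst].
pose th t x := m t * dot E x + b t.
pose w t x := u t (x + a t *: E) * expi (th t x).
(* Stated for any time set: [I] gives continuity of the solution, its interior gives the
   derivatives. *)
have jth K := jet_affine K E m1c b1c md bd.
pose p t x := re u t (x + a t *: E); pose q t x := im u t (x + a t *: E).
have rew : re w = fun t x => p t x * cos (th t x) + q t x * - sin (th t x).
  by apply/funext => t; apply/funext => x; rewrite /re /w /p /q /re /im mulrN;
    case: (u _ _).
have imw : im w = fun t x => p t x * sin (th t x) + q t x * cos (th t x).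
  by apply/funext => t; apply/funext => x; rewrite /im /w /p /q /re /im;
    case: (u _ _).
have dNsin (r : R) : is_derive r 1 (fun s : R => - sin s) (- cos r).
  exact: is_deriveN.
have dNcos (r : R) : is_derive r 1 (fun s : R => - cos s) (sin r).
  by rewrite -[sin r]opprK; apply: is_deriveN.
have cNsin : continuous (fun s : R => - sin s).
  by move=> r; exact: is_derive_continuous (dNsin r).
have cNcos : continuous (fun s : R => - cos s).
  by move=> r; exact: is_derive_continuous (dNcos r).
have cs : continuous (@sin R) by exact: continuous_sin.
have cc : continuous (@cos R) by exact: continuous_cos.
have Jo : open I° by exact: open_interior.
have jp := jet_shift E Jo a1c ad (C12_on_jet r12).
have jq := jet_shift E Jo a1c ad (C12_on_jet i12).
have jcos := jet_comp cNcos (@is_derive_cos R) dNsin (jth I°).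
have jNsin := jet_comp cs dNsin dNcos (jth I°).
have jsin := jet_comp cNsin (@is_derive_sin R) (@is_derive_cos R) (jth I°).
have jre := jetD (jetM jp jcos) (jetM jq jNsin).
have jim := jetD (jetM jp jsin) (jetM jq jcos).
split.
- have cth : cont_on I th := jet_cont (jth I).
  have cp : cont_on I p by exact: cont_on_shift.
  have cq : cont_on I q by exact: cont_on_shift.
  split; rewrite -/w ?rew ?imw.
    exact: cont_onD (cont_onM cp (cont_on_comp cc cth))
                    (cont_onM cq (cont_on_comp cNsin cth)).
  exact: cont_onD (cont_onM cp (cont_on_comp cs cth))
                  (cont_onM cq (cont_on_comp cc cth)).
- split; rewrite -/w ?rew ?imw; first exact: jet_C12_on jre.
  exact: jet_C12_on jim.
- move=> t x Jt; rewrite -/(th t x) -/(w t x).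
  have wE : w t x = re w t x +i* im w t x by rewrite /re /im; case: (w t x).
  (* The phase factor has modulus one, so the nonlinear coefficient is unchanged. *)
  have -> : ComplexField.Normc.normc (w t x) =
      ComplexField.Normc.normc (u t (x + a t *: E)).
    by rewrite /w ComplexField.Normc.normcM normc_expi mulr1.
  have pE : u t (x + a t *: E) = p t x +i* q t x.
    by rewrite /p /q /re /im; case: (u _ _).
  have := eqn t (x + a t *: E) Jt.
  rewrite /cdt /clap wE pE (WV t) rew imw.
  rewrite (jet_dt jre _ Jt) (jet_dt jim _ Jt).
  rewrite (jet_lap jre _ Jt) (jet_lap jim _ Jt).
  rewrite !big_split /= !sum_jet_laplacian /lap.
  rewrite -/(p t x) -/(q t x) -/(th t x).
  exact: frame_equation.
- move=> x; rewrite a0 a10 b0 mul0r oppr0 mul0r addr0 expi0 mulr1.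
  by rewrite scale0r addr0.
Qed.

(** * The two transforms: inversion and transport of solutions *)

Section StarkTransforms.
Variables (R : realType) (n : nat) (eps : R) (E : 'rV[R]_n).
Hypothesis eps_neq0 : eps != 0.
Implicit Types (u v : R -> 'rV[R]_n -> R[i]).

Lemma dotDZr (k : R) (x : 'rV[R]_n) :
  dot E (x + k *: E) = dot E x + k * dot E E.
Proof.
rewrite /dot mulr_sumr -big_split /=; apply: eq_bigr => i _.
by rewrite !mxE; ring.
Qed.

(** Shifting x by - t^2/2 E inside the phase of [to_stark] changes its cubic coefficient from 1/6 to
    1/6 - 1/2 = - 1/3, opposite to the phase of [from_stark]. *)
Lemma to_starkK v : from_stark eps E (to_stark eps E v) = v.
Proof.
apply/funext => t; apply/funext => x; rewrite /from_stark /to_stark subrK.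
rewrite -mulrA -expiD -(scaleNr _ E) dotDZr.
by rewrite (_ : - _ + _ = 0) ?expi0 ?mulr1//; field.
Qed.

Lemma from_starkK u : to_stark eps E (from_stark eps E u) = u.
Proof.
apply/funext => t; apply/funext => x; rewrite /from_stark /to_stark addrK.
rewrite -mulrA -expiD dotDZr.
by rewrite (_ : _ / eps + _ = 0) ?expi0 ?mulr1//; field.
Qed.

(** [to_stark] is a left inverse here, and at time t it reads its argument only at time t. *)
Lemma eq_on_to_stark I u v :
  eq_on I (from_stark eps E u) (from_stark eps E v) -> eq_on I u v.
Proof.
move=> uv t x It; rewrite -[u]from_starkK -[v]from_starkK /to_stark.
by rewrite uv.
Qed.

Lemma is_derive_monomial (k : R) (m : nat) (t : R) :
  is_derive t 1 (fun s : R => k * s ^+ m.+1) (k * m.+1%:R * t ^+ m).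
Proof.
have -> : (fun s : R => k * s ^+ m.+1) = k \*: ((id : R -> R) ^+ m.+1).
  by apply/funext => s; rewrite exprfctE.
by apply: is_derive_eq; rewrite /GRing.scale /= mulr1 mulrA.
Qed.

Lemma continuous_monomial (k : R) (m : nat) :
  continuous (fun s : R => k * s ^+ m.+1).
Proof. by move=> t; exact: is_derive_continuous (is_derive_monomial k m t). Qed.

Variables (lam sigma : R) (I : set R) (u0 : 'rV[R]_n -> R[i]).
(** With a = t^2/2 the frame creates E.x, and [b] is chosen so that - eps b' = t^2/2 |E|^2 cancels -
    a'^2/2 |E|^2. *)
Lemma to_stark_solution v :
  solves_N eps lam sigma I u0 v ->
  solves_S eps lam sigma E I u0 (to_stark eps E v).
Proof.
pose b (t : R) := - (t ^+ 3 / 6 * dot E E / eps).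
have -> : to_stark eps E v = fun t x =>
    v t (x + (t ^+ 2 / 2) *: E) * expi (- (t / eps) * dot E x + b t).
  apply/funext => t; apply/funext => x; rewrite /to_stark; congr (_ * expi _).
  by rewrite /b; field.
apply: (@nls_accelerated_frame _ _ _ _ _ _ (fun t => t ^+ 2 / 2) id (cst 1) b
  (fun t => - (t ^+ 2 / 2 * dot E E / eps))) => //.
- exact: cst_continuous.
- rewrite (_ : (fun=> _) = fun t => - (2^-1 * dot E E / eps) * t ^+ 2).
    exact: continuous_monomial.
  by apply/funext => t; field.
- move=> t; rewrite (_ : (fun=> _) = fun s => 2^-1 * s ^+ 2).
    by apply: (is_derive_eq (is_derive_monomial _ _ _)); field.
  by apply/funext => s; rewrite mulrC.
- move=> t; rewrite (_ : b = fun s => - (6^-1 * dot E E / eps) * s ^+ 3).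
    by apply: (is_derive_eq (is_derive_monomial _ _ _)); field.
  by apply/funext => s; rewrite /b; field.
- by rewrite expr0n mul0r.
- by rewrite /b expr0n /= !mul0r oppr0.
- by move=> t x /=; field.
Qed.

(** With a = - t^2/2 the term a'' E.x removes E.x. The shifted potential and - a'^2/2 |E|^2 each
    leave - t^2/2 |E|^2, whence - eps b' = t^2 |E|^2. *)
Lemma from_stark_solution u :
  solves_S eps lam sigma E I u0 u ->
  solves_N eps lam sigma I u0 (from_stark eps E u).
Proof.
pose b (t : R) := - (t ^+ 3 / 3 * dot E E / eps).
have -> : from_stark eps E u = fun t x =>
    u t (x + (- (t ^+ 2 / 2)) *: E) * expi (- (- t / eps) * dot E x + b t).
  apply/funext => t; apply/funext => x; rewrite /from_stark scaleNr.
  by congr (_ * expi _); rewrite /b; field.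
apply: (@nls_accelerated_frame _ _ _ _ _ _ (fun t => - (t ^+ 2 / 2)) -%R
  (cst (-1)) b (fun t => - (t ^+ 2 * dot E E / eps))) => //.
- exact: cst_continuous.
- rewrite (_ : (fun=> _) = fun t => - (dot E E / eps) * t ^+ 2).
    exact: continuous_monomial.
  by apply/funext => t; field.
- move=> t; rewrite (_ : (fun=> _) = fun s => - 2^-1 * s ^+ 2).
    by apply: (is_derive_eq (is_derive_monomial _ _ _)); field.
  by apply/funext => s; field.
- move=> t; rewrite (_ : b = fun s => - (3^-1 * dot E E / eps) * s ^+ 3).
    by apply: (is_derive_eq (is_derive_monomial _ _ _)); field.
  by apply/funext => s; rewrite /b; field.
- by rewrite expr0n mul0r oppr0.
- by rewrite oppr0.
- by rewrite /b expr0n /= !mul0r oppr0.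
- by move=> t x /=; rewrite dotDZr; field.
Qed.

End StarkTransforms.

(* In the third part X is the function space in which uniqueness is understood:
   X = setT imposes nothing beyond being a classical solution, and if X is
   stable under to_stark and from_stark then the space for (S) is X as well. *)
Theorem proposition3p1 (R : realType) (n : nat) (eps lam sigma : R)
    (E : 'rV[R]_n) (I : set R) (u0 : 'rV[R]_n -> R[i])
    (eps_gt0 : 0 < eps) (eps_le1 : eps <= 1) (E_neq0 : E != 0)
    (sigma_gt0 : 0 < sigma)
    (sigma_lt : (3 <= n)%N -> sigma < 2 / (n%:R - 2))
    (I_itv : is_interval I) (I0 : I 0) :
  [/\ forall v, solves_N eps lam sigma I u0 v ->
        solves_S eps lam sigma E I u0 (to_stark eps E v),
      forall u, solves_S eps lam sigma E I u0 u ->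
        solves_N eps lam sigma I u0 (from_stark eps E u)
    & forall X : set (R -> 'rV[R]_n -> R[i]),
        let N_X := solves_N eps lam sigma I u0 `&` X in
        let S_X := solves_S eps lam sigma E I u0
                     `&` [set u | X (from_stark eps E u)] in
        (at_most_one I N_X -> at_most_one I S_X) /\
        (forall v, is_unique I N_X v -> is_unique I S_X (to_stark eps E v))].
Proof.
have eps_neq0 : eps != 0 by rewrite gt_eqF.
split=> [v|u|X N_X S_X]; [exact: to_stark_solution|exact: from_stark_solution|].
split=> [uniq u w [Su Xu] [Sw Xw]|v [[Nv Xv] uniq]].
  (* The images under [from_stark] solve (N) and lie in [X], so they agree on [I]; this agreement is
     pulled back. *)
  by apply: (eq_on_to_stark (E := E) eps_neq0); apply: uniq; split=> //;
    exact: from_stark_solution.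
split=> [|w [Sw Xw]].
  (* By [to_starkK], the space condition on [to_stark eps E v] is [X v]. *)
  by split; [exact: to_stark_solution|rewrite /= to_starkK].
apply: (eq_on_to_stark (E := E) eps_neq0); rewrite to_starkK//.
by apply: uniq; split=> //; exact: from_stark_solution.
Qed.
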